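(* Let $\alpha>0$ and $\xi<0$. Let $c_0$ be the linear functional associated to the measure $(x-\xi)x^{\alpha-1}e^{-x}dx$ on $]0,+\infty[$ and $c_1$ the one associated to $x^{\alpha}e^{-x}dx$ on $]0,+\infty[$. The monic polynomials $P_n(x,\xi)$ orthogonal with respect to $c_0$ satisfy, for all $n\ge 0$, $$P_n(x,\xi)=N_n^{\alpha-1}(x,\xi)\,\frac{k_n^{\alpha-1}}{L_n^{\alpha-1}(\xi)},\qquad N_n^{\alpha-1}(x,\xi)=\sum_{j=0}^n\frac{L_j^{\alpha-1}(x)L_j^{\alpha-1}(\xi)}{k_j^{\alpha-1}}.$$ The square norm $k_n^{(0)}=c_0(P_n(x,\xi)^2)$ and the coefficient $\sigma_n$ of the coherence relation are given by $$k_n^{(0)}=-n!\,\Gamma(\alpha+n)\frac{L_{n+1}^{\alpha-1}(\xi)}{L_n^{\alpha-1}(\xi)}\ \ (n\ge0),\qquad \sigma_n=n(n+\alpha)\frac{L_n^{\alpha-1}(\xi)}{L_{n+1}^{\alpha-1}(\xi)}\ \ (n\ge1).$$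
   Context: For $a>-1$, $L_n^{a}$ denotes the monic Laguerre-Sonin polynomial of degree $n$, orthogonal with respect to $x^{a}e^{-x}dx$ on $]0,+\infty[$, and $k_n^{a}=\int_0^\infty (L_n^{a}(x))^2x^{a}e^{-x}dx=n!\,\Gamma(a+n+1)$. The pair $(c_0,c_1)$ is coherent: $\sigma_n$ ($n\ge1$) is the real number such that $T_n(x)=\frac{P_{n+1}'(x,\xi)}{n+1}-\sigma_n\frac{P_n'(x,\xi)}{n}$, where $T_n=L_n^{\alpha}$ is the monic orthogonal polynomial with respect to $c_1$ and $'$ is the derivative in $x$. *)

(* Defs.v *)
From mathcomp Require Export all_boot all_order all_algebra.
From mathcomp Require Export all_classical all_reals all_analysis.

Set Implicit Arguments.
Unset Strict Implicit.
Unset Printing Implicit Defensive.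

Import Order.TTheory GRing.Theory Num.Theory.
Import numFieldNormedType.Exports.

Local Open Scope classical_set_scope.
Local Open Scope ring_scope.

Definition weight_functional (R : realType) (w : R -> R) (p : {poly R}) : R :=
  \int[lebesgue_measure]_(x in `]0, +oo[) (p.[x] * w x).

Definition is_monic_orthogonal (R : realType) (c : {poly R} -> R)
    (P : nat -> {poly R}) : Prop :=
  [/\ forall n, P n \is monic,
      forall n, size (P n) = n.+1,
      forall m n, m != n -> c (P m * P n) = 0 &
      forall n, c (P n ^+ 2) != 0].

(* The conditions determine the sequence for a linear functional c; the default
   value of the choice operator is only returned when no such sequence exists. *)
Definition monic_orthogonal (R : realType) (c : {poly R} -> R) :
    nat -> {poly R} :=
  xget (fun=> 0) [set P | is_monic_orthogonal c P].

Definition Gamma (R : realType) (s : R) : R :=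
  \int[lebesgue_measure]_(t in `]0, +oo[) (t `^ (s - 1) * expR (- t)).

Definition laguerre_functional (R : realType) (a : R) : {poly R} -> R :=
  weight_functional (fun x => x `^ a * expR (- x)).

Definition laguerre (R : realType) (a : R) : nat -> {poly R} :=
  monic_orthogonal (laguerre_functional a).

Definition laguerre_norm (R : realType) (a : R) (n : nat) : R :=
  laguerre_functional a (laguerre a n ^+ 2).

Definition laguerre_kernel (R : realType) (a : R) (n : nat) (x y : R) : R :=
  \sum_(j < n.+1) (laguerre a j).[x] * (laguerre a j).[y] / laguerre_norm a j.

Definition c0 (R : realType) (alpha xi : R) : {poly R} -> R :=
  weight_functional (fun x => (x - xi) * x `^ (alpha - 1) * expR (- x)).

Definition c1 (R : realType) (alpha : R) : {poly R} -> R :=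
  laguerre_functional alpha.

Definition coherence_relation (R : realType) (P T : nat -> {poly R}) (n : nat)
    (sigma : R) : Prop :=
  T n = (n.+1%:R)^-1 *: (P n.+1)^`() - (sigma / n%:R) *: (P n)^`().

(* Main.v *)
Require Import Defs.
From mathcomp Require Import measurable_realfun ring lra.

(* Write a = alpha - 1. Since c0 p = c_a ((X - xi) p), where c_a is the Laguerre
   functional, the reproducing property of the kernel K_n of (L_j^a) gives
   c0 (K_n(., xi) q) = ((X - xi) q)(xi) = 0 for deg q < n, so P_n is the monic
   multiple of K_n(., xi). Testing against q = L_n^a gives the norm, and
   K_(n+1) - K_n is a multiple of L_(n+1)^a, which, after differentiation with
   (L_(n+1)^a)' = (n+1) L_n^alpha, is the coherence relation.
   Orthogonality, norms and derivatives of the L_n^a follow from the raising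
   operator x p' + (a + 1 - x) p, which c_a annihilates, and
   (-1)^n L_n^a(xi) > 0 because the coefficients of L_n^a alternate in sign. *)

Set Implicit Arguments.
Unset Strict Implicit.
Unset Printing Implicit Defensive.

Import Order.TTheory GRing.Theory Num.Theory.
Import numFieldNormedType.Exports.

Local Open Scope classical_set_scope.
Local Open Scope ring_scope.


(** * Integration on ]0, +oo[ and the Gamma function *)

Section ftc.
Variable R : realType.
Notation mu := (@lebesgue_measure R).
Implicit Types f F g G : R -> R.

Lemma continuous_pos_measurable f :
  (forall x : R, 0 < x -> {for x, continuous f}) ->
  measurable_fun (`]0, +oo[ : set R) f.
Proof.
move=> cf; apply: open_continuous_measurable_fun => //.
by move=> x; rewrite inE/= in_itv/= andbT => /cf.
Qed.

(** The rays [1/(n+1), +oo[ exhaust the domain. On each of them F is continuous up to the end point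
    and the fundamental theorem applies; monotone convergence then gives the limit. Only the limit
    of F at 0+ enters, so f may blow up at 0. *)
Lemma ge0_FTC0y f F (l0 l : R) :
  (forall x : R, 0 < x -> 0 <= f x) ->
  (forall x : R, 0 < x -> {for x, continuous f}) ->
  (forall x : R, 0 < x -> is_derive x 1 F (f x)) ->
  F x @[x --> 0^'+] --> l0 -> F x @[x --> +oo] --> l ->
  (\int[mu]_(x in `]0%R, +oo[) (f x)%:E = (l - l0)%:E)%E.
Proof.
move=> f0 cf dF Fl0 Fl.
have n0 n : 0 < n.+1%:R^-1 :> R by rewrite invr_gt0.
have FTCn n : (\int[mu]_(x in `[n.+1%:R^-1%R, +oo[) (f x)%:E =
    (l - F n.+1%:R^-1)%:E)%E.
  have cF (x : R) : 0 < x -> {for x, continuous F}.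
    move=> /dF dFx.
    by apply: differentiable_continuous; apply/derivable1_diffP.
  apply: ge0_continuous_FTC2y => //.
  - by move=> x nx; apply: f0; exact: lt_le_trans nx.
  - apply: continuous_in_subspaceT => x; rewrite inE/= in_itv/= andbT => nx.
    by apply: cf; exact: lt_le_trans nx.
  - move=> x nx; have /dF dFx : 0 < x by exact: lt_trans nx.
    by [].
  - exact: cvg_at_right_filter (cF _ (n0 n)).
  - move=> x; rewrite in_itv/= andbT => nx.
    have /dF dFx : 0 < x by exact: lt_trans nx.
    by rewrite derive1E derive_val.
have -> : `]0%R, +oo[%classic =
    \bigcup_n `[(n.+1%:R^-1 : R), +oo[%classic.
  apply/seteqP; split => x /=.
    (* The index trunc(1/x) works because 1/x < trunc(1/x) + 1. *)
    rewrite in_itv/= andbT => x0; exists (Num.trunc x^-1) => //=.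
    rewrite in_itv/= andbT invf_ple ?posrE//.
    exact/ltW/truncnS_gt.
  by move=> [n _] /=; rewrite !in_itv/= !andbT; exact: lt_le_trans.
pose S n := `[(n.+1%:R^-1 : R), +oo[%classic.
have ndS : nondecreasing_seq S.
  apply/nondecreasing_seqP => n; apply/subsetPset => x /=.
  rewrite /S/= !in_itv/= !andbT; apply: le_trans.
  by rewrite lef_pV2 ?posrE// ler_nat.
have mS n : measurable (S n) by exact: measurable_itv.
have mf n : measurable_fun (S n) (EFin \o f).
  apply/measurable_EFinP.
  apply: (@measurable_funS _ _ _ _ (`]0, +oo[ : set R)) => //.
    by move=> x; rewrite /S/= !in_itv/= !andbT; exact: lt_le_trans.
  exact: continuous_pos_measurable.
have S0 n x : S n x -> (0 <= (EFin \o f) x)%E.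
  rewrite /S/= in_itv/= andbT lee_fin => nx.
  by apply: f0; exact: lt_le_trans nx.
have cvS := @ge0_nondecreasing_set_cvg_integral _ _ _ _ _ mu ndS mS mf S0.
have cvL : (\int[mu]_(x in S n) (EFin \o f) x)%E @[n --> \oo] --> (l - l0)%:E.
  under eq_cvg do rewrite /= /S FTCn.
  apply: cvg_EFin; first exact: nearW.
  apply: cvgB; first exact: cvg_cst.
  move: Fl0 => /cvg_at_rightP; apply; split => //.
  exact: cvg_harmonic.
exact: (cvg_unique (@ereal_hausdorff R) cvS cvL).
Qed.


Lemma ge0_integrable0y f F (l0 l : R) :
  (forall x : R, 0 < x -> 0 <= f x) ->
  (forall x : R, 0 < x -> {for x, continuous f}) ->
  (forall x : R, 0 < x -> is_derive x 1 F (f x)) ->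
  F x @[x --> 0^'+] --> l0 -> F x @[x --> +oo] --> l ->
  mu.-integrable `]0, +oo[ (EFin \o f).
Proof.
move=> f0 cf dF Fl0 Fl; apply/integrableP; split.
  by apply/measurable_EFinP; exact: continuous_pos_measurable.
under eq_integral => x do [rewrite inE/= in_itv/= andbT => x0;
  rewrite ger0_norm ?f0//].
by rewrite (ge0_FTC0y f0 cf dF Fl0 Fl) ltry.
Qed.

(** Adding g removes the sign condition: f + g is nonnegative with primitive F + G, so the
    nonnegative case applies to f + g and to g, and subtraction leaves f. *)
Lemma dominated_FTC0y f F g G (l0 l m0 m : R) :
  (forall x : R, 0 < x -> `|f x| <= g x) ->
  (forall x : R, 0 < x -> {for x, continuous f}) ->
  (forall x : R, 0 < x -> {for x, continuous g}) ->
  (forall x : R, 0 < x -> is_derive x 1 F (f x)) ->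
  (forall x : R, 0 < x -> is_derive x 1 G (g x)) ->
  F x @[x --> 0^'+] --> l0 -> F x @[x --> +oo] --> l ->
  G x @[x --> 0^'+] --> m0 -> G x @[x --> +oo] --> m ->
  \int[mu]_(x in `]0, +oo[) f x = l - l0.
Proof.
move=> fg cf cg dF dG Fl0 Fl Gm0 Gm.
have g0 (x : R) : 0 < x -> 0 <= g x by move=> /fg; exact: le_trans.
have fg0 (x : R) : 0 < x -> 0 <= f x + g x.
  by move=> /fg; rewrite ler_norml addrC -lerBlDl sub0r => /andP[].
have cfg (x : R) : 0 < x -> {for x, continuous (fun x => f x + g x)}.
  by move=> x0; apply: continuousD; [exact: cf|exact: cg].
have dFG (x : R) : 0 < x -> is_derive x 1 (fun x => F x + G x) (f x + g x).
  by move=> x0; have := dF _ x0; have := dG _ x0 => ? ?; exact: is_deriveD.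
have FGl0 : F x + G x @[x --> 0^'+] --> l0 + m0 by exact: cvgD.
have FGl : F x + G x @[x --> +oo] --> l + m by exact: cvgD.
have ig := ge0_integrable0y g0 cg dG Gm0 Gm.
have jf : mu.-integrable `]0, +oo[ (EFin \o f).
  apply: le_integrable ig => //.
    by apply/measurable_EFinP; exact: continuous_pos_measurable.
  move=> x /=; rewrite in_itv/= andbT => x0.
  by rewrite lee_fin (ger0_norm (g0 _ x0)) fg.
have Rf : \int[mu]_(x in `]0, +oo[) (f x + g x) = l + m - (l0 + m0).
  by rewrite /Rintegral (ge0_FTC0y fg0 cfg dFG FGl0 FGl).
have Rg : \int[mu]_(x in `]0, +oo[) g x = m - m0.
  by rewrite /Rintegral (ge0_FTC0y g0 cg dG Gm0 Gm).
move: Rf; rewrite RintegralD// Rg => /(canRL (addrK _)) ->.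
by ring.
Qed.

End ftc.

(** * Integrability of x^s e^-x and the functional equation of Gamma *)

Section gamma_integrals.
Variable R : realType.
Notation mu := (@lebesgue_measure R).
Implicit Types s x : R.

Definition gamma_density s x : R := x `^ s * expR (- x).

(** With m = trunc(s) + 1 > s, (1 + x)^s <= (1 + x)^m <= m! e^(1+x); the shift by 1 in the exponent
    accounts for the factor e in the constant. *)
Lemma powR1Dx_expRN_bounded s :
  exists2 C : R, 0 < C & forall x, 0 < x -> (1 + x) `^ s * expR (- x) <= C.
Proof.
pose n := Num.trunc s.
exists (n.+1`!%:R * expR 1); first by rewrite mulr_gt0 ?expR_gt0// ltr0n fact_gt0.
move=> x x0; have x1 : 0 < 1 + x by rewrite addr_gt0.
apply: (@le_trans _ _ ((1 + x) ^+ n.+1 * expR (- x))).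
  rewrite ler_wpM2r ?expR_ge0// -powR_mulrn ?(ltW x1)//.
  apply: ler_powR; first by rewrite lerDl ltW.
  exact/ltW/truncnS_gt.
rewrite expRN ler_pdivrMr ?expR_gt0// -mulrA -expRD -ler_pdivrMl ?ltr0n ?fact_gt0//.
rewrite mulrC; apply: le_trans (expR_ge1Dxn n (ltW x1)).
by rewrite lerDr.
Qed.

Lemma inv1D_cvgy : (1 + x)^-1 @[x --> +oo] --> (0 : R).
Proof.
have pos : \forall x \near +oo, 0 < 1 + x :> R.
  by near=> x; rewrite addr_gt0.
exact: (gtr0_cvgV0 pos).2 (cvg_addrl 1).
Unshelve. all: by end_near. Qed.

(* The derivative of the bounded function (x / (1 + x))^(s + 1) dominates
   x^s e^-x, whose own primitive is not elementary. *)
Definition odds_powR p x : R := (x / (1 + x)) `^ p.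
Definition odds_powR' p x : R := p * (x / (1 + x)) `^ (p - 1) * (1 + x) ^- 2.

Lemma is_derive_odds_powR p x : 0 < x -> is_derive x 1 (odds_powR p) (odds_powR' p x).
Proof.
move=> x0; have x1 : 0 < 1 + x by rewrite addr_gt0.
have xx1 : 0 < x / (1 + x) by rewrite divr_gt0.
have /= d1 := is_derive1_powR p xx1.
have d2 : is_derive x 1 (fun y => y / (1 + y)) ((1 + x) ^- 2).
  have d3 : is_derive x 1 (fun y : R => (1 + y)^-1) (- (1 + x) ^- 2 *: (0 + 1)).
    by apply: is_deriveV; rewrite gt_eqF.
  apply: is_derive_eq.
  rewrite /GRing.scale/=; field.
  by rewrite gt_eqF.
exact: (@is_derive1_comp R (@powR R ^~ p) (fun y => y / (1 + y)) x _ _ d1 d2).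
Qed.

Lemma odds_powR_cvg0 p : 0 < p -> odds_powR p x @[x --> 0^'+] --> (0 : R).
Proof.
move=> p0; apply: (squeeze_cvgr _ (cvg_cst 0) (powR_cvg0 p0)).
near=> x; have x0 : 0 < x by [].
rewrite powR_ge0/= ge0_ler_powR ?ltW// ?nnegrE ?ltW ?divr_gt0 ?addr_gt0//.
by rewrite ltr_pdivrMr ?addr_gt0// mulrDr mulr1 ltrDl mulr_gt0.
Unshelve. all: by end_near. Qed.

Lemma odds_powR_cvgy p : odds_powR p x @[x --> +oo] --> (1 : R).
Proof.
have c1 : {for 1, continuous (@powR R ^~ p)}.
  have d1 := is_derive1_powR p (@ltr01 R).
  by apply: differentiable_continuous; apply/derivable1_diffP.
have c2 : x / (1 + x) @[x --> +oo] --> (1 : R).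
  rewrite -[X in _ --> X](subr0 1).
  apply: (@cvg_trans _ ((1 - (1 + x)^-1) @[x --> +oo])).
    apply: near_eq_cvg; near=> x; field.
    by rewrite gt_eqF// addr_gt0.
  apply: cvgB; first exact: cvg_cst.
  exact: inv1D_cvgy.
by have := cvg_comp _ _ c2 c1; rewrite powR1.
Unshelve. all: by end_near. Qed.

(** The factor 1 + s + x lets one bound serve twice: it exceeds s + 1, which gives integrability,
    and it exceeds |s + 1 - x|, which controls the integrand of the integration by parts. *)
Lemma gamma_density_dominated s : -1 < s ->
  exists2 C : R, 0 < C & forall x, 0 < x ->
    (1 + s + x) * gamma_density s x <= C * odds_powR' (s + 1) x.
Proof.
move=> s1; have p0 : 0 < s + 1 by rewrite -ltrBlDr sub0r.
(* The right-hand side is a multiple of x^s (1 + x)^(-s-2), and the linear factor on the left costs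
   one more power of 1 + x, hence s + 3. *)
have [C C0 HC] := powR1Dx_expRN_bounded (s + 3).
(* The factor s + 2 comes from 1 + s + x <= (s + 2)(1 + x); dividing by s + 1 cancels the exponent
   brought down in [odds_powR']. *)
exists ((s + 2) * C / (s + 1)).
  by rewrite !mulr_gt0 ?invr_gt0//; lra.
move=> x x0; have x1 : 0 < 1 + x by rewrite addr_gt0.
rewrite /gamma_density /odds_powR' addrK powRM ?invr_ge0 ?(ltW x0) ?(ltW x1)//.
rewrite -(powR_inv1 (ltW x1)) -powRrM mulN1r.
have -> : (1 + x) ^- 2 = (1 + x) `^ (- 2) by rewrite powR_invn ?ltW.
rewrite (_ : _ * (_ * _ * _) =
    (s + 2) * (x `^ s * (C * (1 + x) `^ (- s - 2)))); last first.
  rewrite powRD; last by rewrite (gt_eqF x1) ?implybT.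
  by field; rewrite (gt_eqF _)//; lra.
have {HC} := HC _ x0.
rewrite (_ : s + 3 = 1 + (s + 2)); last by ring.
rewrite powRD; last by rewrite (gt_eqF x1) implybT.
rewrite powRr1 ?(ltW x1)// => HC.
apply: (@le_trans _ _ ((s + 2) * (1 + x) * (x `^ s * expR (- x)))).
  rewrite ler_wpM2r ?mulr_ge0 ?powR_ge0 ?expR_ge0//.
  by rewrite -subr_ge0 (_ : _ - _ = 1 + (s + 1) * x); [nra|ring].
rewrite -mulrA ler_wpM2l//; first by lra.
rewrite mulrCA ler_wpM2l ?powR_ge0//.
rewrite (_ : - s - 2 = - (s + 2)); last by ring.
by rewrite powRN ler_pdivlMr ?powR_gt0// mulrAC.
Qed.

(** For x >= 1, x^s <= (1 + x)^|s|; bounding one power more than |s| leaves the majorant C / (1 +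
    x). *)
Lemma gamma_density_cvgy s : gamma_density s x @[x --> +oo] --> (0 : R).
Proof.
have [C C0 HC] := powR1Dx_expRN_bounded (`|s| + 1).
apply: (squeeze_cvgr (f := cst 0) (h := fun x => C * (1 + x)^-1)).
- near=> x; have x0 : 0 < x by [].
  have x1 : 0 < 1 + x by rewrite addr_gt0.
  rewrite mulr_ge0 ?powR_ge0 ?expR_ge0//= ler_pdivlMr//.
  apply: le_trans (HC _ x0); rewrite powRD; last by rewrite (gt_eqF x1) ?implybT.
  rewrite powRr1 ?(ltW x1)// /gamma_density mulrAC ler_wpM2r ?expR_ge0//.
  rewrite ler_wpM2r ?(ltW x1)//.
  have x1' : 1 <= x by near: x; exact: nbhs_pinfty_ge.
  apply: (@le_trans _ _ (x `^ `|s|)); first exact/ler_powR/ler_norm.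
  by rewrite ge0_ler_powR// ?nnegrE ?(ltW x0) ?(ltW x1)// lerDr.
- exact: cvg_cst.
- rewrite -[X in _ --> X](mulr0 C); apply: cvgMr.
  exact: inv1D_cvgy.
Unshelve. all: by end_near. Qed.


Lemma gamma_density_ge0 s x : 0 <= gamma_density s x.
Proof. by rewrite mulr_ge0 ?powR_ge0 ?expR_ge0. Qed.

Lemma gamma_densityS s x : 0 < x -> gamma_density (s + 1) x = x * gamma_density s x.
Proof.
move=> x0; rewrite /gamma_density powRD; last by rewrite (gt_eqF x0) implybT.
by rewrite powRr1 ?ltW//; ring.
Qed.

Lemma is_derive_gamma_density s x : 0 < x ->
  is_derive x 1 (gamma_density s) (s * gamma_density (s - 1) x - gamma_density s x).
Proof.
move=> x0; have /= d1 := is_derive1_powR s x0.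
have d2 : is_derive x 1 (fun y => expR (- y)) (expR (- x) * (- 1)).
  exact: (@is_derive1_comp R (@expR R) -%R).
apply: (is_derive_eq (is_deriveM d1 d2)).
by rewrite /gamma_density /GRing.scale/=; ring.
Qed.

Lemma continuous_gamma_density s x : 0 < x ->
  {for x, continuous (gamma_density s)}.
Proof.
move=> /(is_derive_gamma_density s) d.
by apply: differentiable_continuous; apply/derivable1_diffP.
Qed.

Lemma continuous_odds_powR' p x : 0 < x -> {for x, continuous (odds_powR' p)}.
Proof.
move=> x0; have x1 : 0 < 1 + x by rewrite addr_gt0.
apply: continuousM.
  apply: continuousM; first exact: cvg_cst.
  have d := is_derive_odds_powR (p - 1) x0.
  by apply: differentiable_continuous; apply/derivable1_diffP.
apply: continuousV; first by rewrite expf_neq0// gt_eqF.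
have c : {for x, continuous (fun y : R => 1 + y)}.
  by apply: continuousD; [exact: cvg_cst|exact: cvg_id].
exact: (continuousM c c).
Qed.

Lemma gamma_density_cvg0 s : 0 < s -> gamma_density s x @[x --> 0^'+] --> (0 : R).
Proof.
move=> s0; have e0 : expR (- x) @[x --> (0 : R)^'+] --> expR (- 0).
  apply: cvg_at_right_filter; apply: cvg_comp; last exact: continuous_expR.
  exact: cvgN.
rewrite -[X in _ --> X](mul0r (expR (- 0))).
exact: cvgM (powR_cvg0 s0) e0.
Qed.

Lemma integrable_gamma_density s : -1 < s ->
  mu.-integrable `]0, +oo[ (EFin \o gamma_density s).
Proof.
move=> s1; have p0 : 0 < s + 1 by lra.
have [C C0 HC] := gamma_density_dominated s1.
have ib : mu.-integrable `]0, +oo[ (EFin \o odds_powR' (s + 1)).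
  apply: (ge0_integrable0y _ _ _ (odds_powR_cvg0 p0) (@odds_powR_cvgy _)).
  - move=> x x0; rewrite mulr_ge0// ?invr_ge0 ?exprn_ge0 ?addr_ge0 ?(ltW x0)//.
    by rewrite mulr_ge0 ?powR_ge0 ?(ltW p0).
  - by move=> x; exact: continuous_odds_powR'.
  - by move=> x; exact: is_derive_odds_powR.
apply: le_integrable (integrableZl _ (C / (s + 1)) ib) => //.
  apply/measurable_EFinP; apply: continuous_pos_measurable => x.
  exact: continuous_gamma_density.
move=> x /=; rewrite in_itv/= andbT => x0; rewrite lee_fin.
rewrite (ger0_norm (gamma_density_ge0 _ _)); apply: le_trans (ler_norm _).
rewrite mulrAC ler_pdivlMr// mulrC; apply: le_trans (HC x x0).
by rewrite ler_wpM2r ?gamma_density_ge0//; lra.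
Qed.

(** Integration by parts: (s + 1) x^s e^-x - x^(s+1) e^-x is the derivative of x^(s+1) e^-x, which
    tends to 0 at both ends because s + 1 > 0. *)
Lemma Rintegral_gamma_densityS s : -1 < s ->
  \int[mu]_(x in `]0, +oo[) gamma_density (s + 1) x =
  (s + 1) * \int[mu]_(x in `]0, +oo[) gamma_density s x.
Proof.
move=> s1; have p0 : 0 < s + 1 by lra.
have [C C0 HC] := gamma_density_dominated s1.
pose f x := (s + 1) * gamma_density s x - gamma_density (s + 1) x.
have : \int[mu]_(x in `]0, +oo[) f x = 0 - 0.
  apply: (dominated_FTC0y (F := gamma_density (s + 1))
    (g := fun x => C * odds_powR' (s + 1) x) (G := fun x => C * odds_powR (s + 1) x)
    (m0 := C * 0) (m := C * 1)).
  - move=> x x0; apply: le_trans (HC x x0).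
    rewrite /f gamma_densityS// -mulrBl normrM (ger0_norm (gamma_density_ge0 _ _)).
    rewrite ler_wpM2r ?gamma_density_ge0//.
    by rewrite ler_norml; apply/andP; split; lra.
  - move=> x x0; apply: continuousB; last exact: continuous_gamma_density.
    by apply: continuousM; [exact: cvg_cst|exact: continuous_gamma_density].
  - move=> x x0; apply: continuousM; first exact: cvg_cst.
    exact: continuous_odds_powR'.
  - move=> x x0; have := is_derive_gamma_density (s + 1) x0.
    by rewrite addrK.
  - by move=> x x0; have d := is_derive_odds_powR (s + 1) x0; exact: is_deriveZ.
  - exact: gamma_density_cvg0.
  - exact: gamma_density_cvgy.
  - by apply: cvgMr; exact: odds_powR_cvg0.
  - by apply: cvgMr; exact: odds_powR_cvgy.
rewrite /f RintegralB//; last 2 first.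
- exact: (integrableZl _ (s + 1) (integrable_gamma_density s1)).
- by apply: integrable_gamma_density; lra.
rewrite RintegralZl//; last exact: integrable_gamma_density.
by rewrite subrr => /eqP; rewrite subr_eq0 => /eqP ->.
Qed.

Lemma GammaE s : Gamma s = \int[mu]_(x in `]0, +oo[) gamma_density (s - 1) x.
Proof. by []. Qed.

Lemma GammaS s : 0 < s -> Gamma (s + 1) = s * Gamma s.
Proof.
move=> s0; rewrite !GammaE addrK -{1 2}(subrK 1 s).
by apply: Rintegral_gamma_densityS; lra.
Qed.

(** The functional equation moves the claim to Gamma(s + 1), whose integrand x^s e^-x is at least
    e^-2 on [1, 2], since x^s >= 1 there. *)
Lemma Gamma_gt0 s : 0 < s -> 0 < Gamma s.
Proof.
move=> s0; rewrite -(pmulr_rgt0 _ s0) -GammaS// GammaE addrK.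
have i12 : mu.-integrable (`[1, 2] : set R) (EFin \o gamma_density s).
  apply: (@integrableS _ _ _ mu (`]0, +oo[ : set R)) => //.
    by move=> x /=; rewrite !in_itv/= andbT => /andP[x1 _]; lra.
  by apply: integrable_gamma_density; lra.
have m12 : mu (`[1, 2] : set R) = 1%E.
  by rewrite lebesgue_measure_itv/= lte_fin ltr1n/= -EFinB; congr EFin; ring.
have e0 := expR_gt0 (- 2 : R).
have H : expR (- 2) <= \int[mu]_(x in `[1, 2]) gamma_density s x.
  have -> : expR (- 2) = \int[mu]_(x in `[1, 2]) (cst (expR (- 2)) x).
    by rewrite Rintegral_cst// [X in fine X]m12 mulr1.
  apply: le_Rintegral => //.
    apply: measurable_bounded_integrable => //; last exact: bounded_cst.
    by rewrite [X in (X < _)%E]m12 ltry.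
  move=> x /=; rewrite in_itv/= => /andP[x1 x2].
  rewrite /gamma_density -[leLHS]mul1r ler_pM ?expR_ge0//.
    by rewrite -(powRr0 x); apply: ler_powR => //; exact: ltW.
  by rewrite ler_expR lerN2.
apply: lt_le_trans e0 _; apply: le_trans H _.
rewrite /Rintegral fine_le//.
- exact: integrable_fin_num.
- by apply: integrable_fin_num => //; apply: integrable_gamma_density; lra.
apply: ge0_subset_integral => //.
- apply/measurable_EFinP; apply: continuous_pos_measurable => x.
  exact: continuous_gamma_density.
- by move=> x _; rewrite lee_fin gamma_density_ge0.
- by move=> x /=; rewrite !in_itv/= andbT => /andP[x1 _]; lra.
Qed.

End gamma_integrals.

(** * The Laguerre functional on polynomials *)

Section laguerre_functional.
Variable R : realType.
Notation mu := (@lebesgue_measure R).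
Implicit Types (a : R) (p q : {poly R}).

(** A factor X turns the exponent a into a + 1, so a has to vary in the induction on p. *)
Lemma integrable_poly_gamma_density a p : -1 < a ->
  mu.-integrable `]0, +oo[ (EFin \o (fun x => p.[x] * gamma_density a x)).
Proof.
elim/poly_ind: p a => [|p c IHp] a a1.
  have := integrable0 (R := R) mu (`]0, +oo[ : set R).
  by apply: eq_integrable => // x _ /=; rewrite horner0 mul0r.
have a2 : -1 < a + 1 by lra.
have ic : mu.-integrable `]0, +oo[ (EFin \o (fun x => c * gamma_density a x)).
  by apply: (integrableZl _ c (integrable_gamma_density a1)).
apply: eq_integrable (integrableD _ (IHp _ a2) ic) => // x.
rewrite inE/= in_itv/= andbT => x0.
rewrite /= gamma_densityS// -EFinD hornerMXaddC; congr EFin; ring.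
Qed.

Lemma laguerre_functionalD a p q : -1 < a ->
  laguerre_functional a (p + q) = laguerre_functional a p + laguerre_functional a q.
Proof.
move=> a1; rewrite /laguerre_functional /weight_functional -RintegralD//.
- by apply: eq_Rintegral => x _; rewrite hornerD mulrDl.
- exact: integrable_poly_gamma_density.
- exact: integrable_poly_gamma_density.
Qed.

Lemma laguerre_functionalZ a c p : -1 < a ->
  laguerre_functional a (c *: p) = c * laguerre_functional a p.
Proof.
move=> a1; have ip := integrable_poly_gamma_density p a1.
rewrite /laguerre_functional /weight_functional -RintegralZl//.
by apply: eq_Rintegral => x _; rewrite hornerZ -mulrA.
Qed.

Lemma laguerre_functionalX a p :
  laguerre_functional a ('X * p) = laguerre_functional (a + 1) p.
Proof.
apply: eq_Rintegral => x; rewrite inE/= in_itv/= andbT => x0.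
rewrite -/(gamma_density (a + 1) x) gamma_densityS// hornerM hornerX.
by rewrite /gamma_density; ring.
Qed.

Lemma laguerre_functional1 a : laguerre_functional a 1 = Gamma (a + 1).
Proof.
rewrite GammaE addrK; apply: eq_Rintegral => x _.
by rewrite hornerC mul1r.
Qed.

(* The weight w(x) = x^a e^-x satisfies (x w)' = (a + 1 - x) w. *)
Lemma laguerre_functional_pearson a p : -1 < a ->
  laguerre_functional a ('X * p^`() + ((a + 1)%:P - 'X) * p) = 0.
Proof.
elim/poly_ind: p a => [|p c IHp] a a1.
  rewrite deriv0 !mulr0 addr0 -(scale0r (0 : {poly R})).
  by rewrite laguerre_functionalZ// mul0r.
have a2 : -1 < a + 1 by lra.
rewrite derivD derivM derivX derivC.
(* For X p + c the expression is X times the one for p with a + 1 in place of a, plus c (a + 1 - X),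
   whose integral vanishes by Gamma(a + 2) = (a + 1) Gamma(a + 1). *)
rewrite (_ : _ + _ = 'X * ('X * p^`() + ((a + 1 + 1)%:P - 'X) * p) +
   ((c * (a + 1)) *: 1 + (- c) *: ('X * 1))); last first.
  by rewrite -!mul_polyC !polyCD polyCM polyCN !polyCD; ring.
rewrite !laguerre_functionalD// !laguerre_functionalZ// !laguerre_functionalX.
rewrite IHp// !laguerre_functional1 [in Gamma (a + 1 + 1)]GammaS; last by lra.
by ring.
Qed.

End laguerre_functional.

(** * Orthogonal polynomials and kernel polynomials *)

Section monic_orthogonal.
Variables (R : realType) (c : {poly R} -> R).
Hypothesis cD : forall p q, c (p + q) = c p + c q.
Hypothesis cZ : forall a p, c (a *: p) = a * c p.

Let c_0 : c 0 = 0. Proof. by rewrite -(scale0r 0) cZ mul0r. Qed.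
Let cB p q : c (p - q) = c p - c q.
Proof. by rewrite cD -scaleN1r cZ mulN1r. Qed.

(** The peeling step behind every expansion in a monic sequence: the top coefficient is
    cancelled. *)
Lemma size_sub_coefZ_monic (p q : {poly R}) n :
  (size p <= n.+1)%N -> size q = n.+1 -> q \is monic ->
  (size (p - p`_n *: q)%R <= n)%N.
Proof.
move=> pn qn /monicP qm; apply/leq_sizeP => j; rewrite leq_eqVlt => /orP[/eqP <-|nj].
  by rewrite coefB coefZ -[X in q`_X]/n.+1.-1 -qn -/(lead_coef q) qm mulr1 subrr.
rewrite coefB coefZ (nth_default 0 (leq_trans pn nj)).
by rewrite [q`_j]nth_default ?qn// mulr0 subr0.
Qed.

Section sequence.
Variable P : nat -> {poly R}.
Hypothesis cP : is_monic_orthogonal c P.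

Let Pmonic n : P n \is monic. Proof. by case: cP. Qed.
Let Psize n : size (P n) = n.+1. Proof. by case: cP. Qed.
Let Porth m n : m != n -> c (P m * P n) = 0. Proof. by case: cP => _ _ + _; apply. Qed.
Let Pnorm n : c (P n ^+ 2) != 0. Proof. by case: cP. Qed.

(** Peeling off top coefficients writes q through P_0, ..., P_(n-1), all orthogonal to P_n. *)
Lemma monic_orthogonal_small n (q : {poly R}) : (size q <= n)%N -> c (P n * q) = 0.
Proof.
(* The size bound m is separated from the index n, so that the induction lowers m alone. *)
move: (leqnn n); move: {1 3}n => m mn.
elim: m q mn => [|m IHm] q mn qm.
  by move: qm; rewrite leqn0 size_poly_eq0 => /eqP ->; rewrite mulr0.
rewrite -(subrK (q`_m *: P m) q) mulrDr cD -scalerAr cZ Porth ?gtn_eqF// mulr0 addr0.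
by apply: IHm; [exact: ltnW|exact: size_sub_coefZ_monic].
Qed.

(** The Christoffel-Darboux kernel, kept as a polynomial in one variable with the other one fixed at
    y. *)
Definition poly_kernel n y := \sum_(j < n.+1) ((P j).[y] / c (P j ^+ 2)) *: P j.

Lemma poly_kernelS n y :
  poly_kernel n.+1 y =
  poly_kernel n y + ((P n.+1).[y] / c (P n.+1 ^+ 2)) *: P n.+1.
Proof. by rewrite /poly_kernel big_ord_recr. Qed.

Lemma size_poly_kernel n y : (size (poly_kernel n y) <= n.+1)%N.
Proof.
rewrite (leq_trans (size_sum _ _ _))//; apply/bigmax_leqP => i _.
by rewrite (leq_trans (size_scale_leq _ _))// Psize ltnS leq_ord.
Qed.

(** Split p into a multiple of P_(n+1) and a rest r of lower degree: the new kernel term is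
    orthogonal to r, and it alone contributes against P_(n+1). *)
Lemma poly_kernel_reproducing n y (p : {poly R}) : (size p <= n.+1)%N ->
  c (poly_kernel n y * p) = p.[y].
Proof.
elim: n p => [|n IHn] p pn.
  rewrite /poly_kernel big_ord1 -scalerAl cZ.
  have P0 : P 0 = 1.
    have /size1_polyC E : (size (P 0) <= 1)%N by rewrite Psize.
    have /monicP := Pmonic 0.
    by rewrite {2}E [in lead_coef _]E lead_coefC => ->.
  have /size1_polyC -> := pn; rewrite hornerC P0 mul1r expr1n hornerC.
  rewrite -(mulr1 (p`_0)%:P) mul_polyC cZ.
  by have := Pnorm 0; rewrite P0 expr1n => h; field.
rewrite -(subrK (p`_n.+1 *: P n.+1) p).
set r := p - _; have rn : (size r <= n.+1)%N by exact: size_sub_coefZ_monic.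
have Kr : c (poly_kernel n.+1 y * r) = r.[y].
  rewrite poly_kernelS mulrDl cD IHn// -scalerAl cZ.
  by rewrite (monic_orthogonal_small rn) mulr0 addr0.
have KP : c (poly_kernel n.+1 y * P n.+1) = (P n.+1).[y].
  rewrite poly_kernelS mulrDl cD (mulrC (poly_kernel n y)).
  rewrite (monic_orthogonal_small (size_poly_kernel n y)) add0r.
  by rewrite -scalerAl cZ -expr2 divfK.
by rewrite mulrDr cD Kr -scalerAr cZ KP [RHS]hornerD hornerZ.
Qed.

(** * Kernel polynomials and multiplication of the functional by X - xi *)

Section christoffel.
Variable xi : R.
Hypothesis Pxi : forall n, (P n).[xi] != 0.

(** P_n has coefficient P_n(xi) / c(P_n^2) in the kernel; the prefactor is its inverse and makes the
    polynomial monic. *)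
Definition christoffel n :=
  (c (P n ^+ 2) / (P n).[xi]) *: poly_kernel n xi.

Lemma christoffelS n : christoffel n.+1 = P n.+1 +
  (c (P n.+1 ^+ 2) / c (P n ^+ 2) * ((P n).[xi] / (P n.+1).[xi])) *: christoffel n.
Proof.
rewrite /christoffel poly_kernelS scalerDr !scalerA addrC; congr (_ + _).
  rewrite -[RHS]scale1r; congr (_ *: _).
  by have := Pnorm n.+1; have := Pxi n.+1 => h h'; field; rewrite h h'.
congr (_ *: _); have := Pnorm n; have := Pxi n; have := Pxi n.+1 => h h' h''.
by field; rewrite h h' h''.
Qed.

Lemma christoffel_monic n : christoffel n \is monic /\ size (christoffel n) = n.+1.
Proof.
case: n => [|n].
  rewrite /christoffel /poly_kernel big_ord1 scalerA (_ : _ * _ = 1) ?scale1r//.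
  by have := Pnorm 0; have := Pxi 0 => h h'; field; rewrite h h'.
rewrite christoffelS; set q := _ *: _.
have qn : (size q < size (P n.+1))%N.
  rewrite Psize ltnS (leq_trans (size_scale_leq _ _))//.
  by rewrite (leq_trans (size_scale_leq _ _))// size_poly_kernel.
split; last by rewrite size_polyDl // Psize.
by apply/monicP; rewrite lead_coefDl//; apply/monicP.
Qed.

(** The product (X - xi) q has degree at most n, so the kernel evaluates it at xi, where it
    vanishes. *)
Lemma christoffel_small n (q : {poly R}) : (size q <= n)%N ->
  c (('X - xi%:P) * (christoffel n * q)) = 0.
Proof.
move=> qn; rewrite mulrCA /christoffel -scalerAl cZ poly_kernel_reproducing.
  by rewrite hornerM hornerXsubC subrr mul0r mulr0.
rewrite (leq_trans (size_polyMleq _ _))// size_XsubC.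
by rewrite add2n/= ltnS.
Qed.

(** One of the two factors may be replaced by P_n, the difference having degree below n. Then (X -
    xi) P_n may be replaced by (X - xi) P_n - P_(n+1), of degree at most n, and the kernel evaluates
    this at xi to -P_(n+1)(xi). *)
Lemma christoffel_norm n : c (('X - xi%:P) * christoffel n ^+ 2) =
  - (c (P n ^+ 2) * ((P n.+1).[xi] / (P n).[xi])).
Proof.
have [Cm Cs] := christoffel_monic n.
have rP : (size (christoffel n - P n)%R <= n)%N.
  have := @size_sub_coefZ_monic (christoffel n) (P n) n.
  have /monicP := Cm; rewrite /lead_coef Cs/= => ->; rewrite scale1r.
  by apply.
rewrite expr2 -{2}(subrK (P n) (christoffel n)) mulrDr mulrDr cD.
rewrite (christoffel_small rP) add0r mulrCA /christoffel -scalerAl cZ.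
set q := ('X - _) * _.
have qm : q \is monic by rewrite monicMl ?monicXsubC.
have qs : size q = n.+2.
  by rewrite size_monicM ?monicXsubC ?monic_neq0// size_XsubC Psize.
have rq : (size (q - P n.+1)%R <= n.+1)%N.
  have := @size_sub_coefZ_monic q (P n.+1) n.+1.
  have /monicP := qm; rewrite /lead_coef qs/= => ->; rewrite scale1r.
  by apply.
rewrite -(subrK (P n.+1) q) mulrDr cD poly_kernel_reproducing//.
rewrite [_ * P n.+1]mulrC (monic_orthogonal_small (size_poly_kernel n xi)) addr0.
rewrite hornerD hornerN /q hornerM hornerXsubC subrr mul0r sub0r.
by rewrite mulrN mulrAC mulrA.
Qed.

Lemma christoffel_orthogonal :
  is_monic_orthogonal (fun p => c (('X - xi%:P) * p)) christoffel.
Proof.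
have sm m n : (m < n)%N -> c (('X - xi%:P) * (christoffel n * christoffel m)) = 0.
  by move=> mn; apply: christoffel_small; rewrite (christoffel_monic m).2.
split => [n|n|m n|n].
- exact: (christoffel_monic n).1.
- exact: (christoffel_monic n).2.
- by rewrite neq_ltn => /orP[mn|nm]; [rewrite [christoffel m * _]mulrC sm|exact: sm].
- by rewrite christoffel_norm oppr_eq0 !mulf_neq0 ?invr_eq0.
Qed.

End christoffel.

End sequence.

(** If r = P_n - Q_n were nonzero of degree m < n, both sequences would give c(P_m r) = 0, whereas
    this number is the leading coefficient of r times c(P_m^2). *)
Lemma monic_orthogonal_unique P Q :
  is_monic_orthogonal c P -> is_monic_orthogonal c Q -> P = Q.
Proof.
move=> cP cQ; apply/funext => n; apply/eqP; rewrite -subr_eq0.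
have [Pm Ps _ Pn] := cP; have [Qm Qs _ _] := cQ.
set r := P n - Q n.
have rn : (size r <= n)%N.
  have := @size_sub_coefZ_monic (P n) (Q n) n; rewrite !Ps Qs => /(_ _ _ (Qm n)).
  have /monicP := Pm n; rewrite /lead_coef Ps/= => ->; rewrite scale1r.
  exact.
rewrite -size_poly_eq0; apply: contraT; rewrite -lt0n => r0.
pose m := (size r).-1; have rm : size r = m.+1 by rewrite prednK.
have : c (P m * r) = 0.
  rewrite mulrC mulrBl cB.
  by rewrite !monic_orthogonal_small ?subr0 ?Ps -?rm.
rewrite -(subrK (r`_m *: P m) r) mulrDr cD -scalerAr cZ.
rewrite monic_orthogonal_small//; last exact: size_sub_coefZ_monic (eq_leq rm) _ _.
rewrite add0r -expr2 => /eqP; rewrite mulf_eq0 (negbTE (Pn m)) orbF.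
by rewrite -[X in r`_X]/m.+1.-1 -rm -/(lead_coef r) lead_coef_eq0 -size_poly_eq0 rm.
Qed.

(** Makes the choice in [monic_orthogonal] computable: exhibiting one orthogonal sequence determines
    it. *)
Lemma monic_orthogonalE P : is_monic_orthogonal c P -> monic_orthogonal c = P.
Proof.
move=> cP; apply: monic_orthogonal_unique => //.
exact: (xgetI (fun=> 0) cP).
Qed.

End monic_orthogonal.

(** * Laguerre polynomials *)

Section laguerre_polynomials.
Variable R : realType.
Implicit Types (a : R) (p q : {poly R}).

(* Rodrigues' formula x^a e^-x L_(n+1)^a = - (x^(a+1) e^-x L_n^(a+1))'. *)
Fixpoint lag a n : {poly R} :=
  if n is n'.+1 then
    ('X - (a + 1)%:P) * lag (a + 1) n' - 'X * (lag (a + 1) n')^`()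
  else 1.

Lemma lag_monic_size a n : lag a n \is monic /\ size (lag a n) = n.+1.
Proof.
elim: n a => [|n IHn] a; first by rewrite monic1 size_poly1.
have [Mm Ms] := IHn (a + 1); rewrite /=; set M := lag _ _ in Mm Ms *.
have qs : size (('X - (a + 1)%:P) * M) = n.+2.
  by rewrite size_monicM ?monicXsubC ?monic_neq0// size_XsubC Ms.
have rs : (size (- ('X * M^`()))%R < size (('X - (a + 1)%:P) * M)%R)%N.
  rewrite qs size_polyN ltnS (leq_trans (size_polyMleq _ _))// size_polyX add2n/=.
  by rewrite -Ms lt_size_deriv ?monic_neq0.
split; last by rewrite size_polyDl.
by apply/monicP; rewrite lead_coefDl//; apply/monicP; rewrite monicMl ?monicXsubC.
Qed.

Lemma lag_lead a n : (lag a n)`_n = 1.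
Proof.
have [/monicP] := lag_monic_size a n.
by rewrite /lead_coef => /[swap] ->.
Qed.

(** With M = L_(n+1)^(a+1) and K = L_n^(a+2), the derivative of the recursion is M + (X - a - 2) M'
    - X M''. Inserting M' = (n + 1) K turns the last two terms into (n + 1) M, again by the
    recursion. *)
Lemma deriv_lagS a n : (lag a n.+1)^`() = n.+1%:R *: lag (a + 1) n.
Proof.
elim: n a => [|n IHn] a.
  by rewrite /= -polyC1 !derivC mulr0 subr0 mulr1 derivXsubC scale1r.
pose M := lag (a + 1) n.+1.
rewrite -/M (_ : lag a n.+2 = ('X - (a + 1)%:P) * M - 'X * M^`())//.
have dM : M^`() = n.+1%:R *: lag (a + 1 + 1) n by exact: IHn.
have ME : M = ('X - (a + 1 + 1)%:P) * lag (a + 1 + 1) n -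
  'X * (lag (a + 1 + 1) n)^`() by [].
move: ME dM; clearbody M; set K := lag _ n => ME dM.
rewrite derivB !derivM dM derivZ derivB derivX derivC -(natr1 n.+1) scalerDl scale1r.
rewrite [in n.+1%:R *: M]ME -!mul_polyC !polyCD.
by ring.
Qed.

(** Integration by parts moves a derivative onto q: c_a(L_(n+1)^a q) = c_(a+1)(L_n^(a+1) q'). After
    n steps only the n-th derivative n! q_n and the mass Gamma(a + n + 1) remain. Orthogonality is
    the case q_n = 0, the norm the case q_n = 1. *)
Lemma laguerre_functional_lag a n q : -1 < a -> (size q <= n.+1)%N ->
  laguerre_functional a (lag a n * q) = q`_n * n`!%:R * Gamma (a + n%:R + 1).
Proof.
elim: n a q => [|n IHn] a q a1 qn.
  have /size1_polyC -> := qn; rewrite coefC/= mul1r -(mulr1 (_)%:P) mul_polyC.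
  by rewrite laguerre_functionalZ// laguerre_functional1 addr0 mulr1.
have a2 : -1 < a + 1 by lra.
set M := lag (a + 1) n.
(* The last summand is the expression annihilated by the functional, taken at M q. *)
have E : lag a n.+1 * q =
    'X * (M * q^`()) + (-1) *: ('X * (M * q)^`() + ((a + 1)%:P - 'X) * (M * q)).
  by rewrite /= -/M derivM scaleN1r; ring.
rewrite E laguerre_functionalD// laguerre_functionalZ// laguerre_functional_pearson//.
rewrite mulr0 addr0 laguerre_functionalX IHn//; last first.
  apply/leq_sizeP => j nj; rewrite coef_deriv nth_default ?mul0rn//.
  exact: leq_trans qn _.
rewrite coef_deriv factS natrM -mulr_natr -(natr1 n).
by rewrite (_ : a + 1 + n%:R = a + (n%:R + 1)); ring.
Qed.

Lemma lag_orthogonal a : -1 < a -> is_monic_orthogonal (laguerre_functional a) (lag a).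
Proof.
move=> a1; have n0 n : 0 <= n%:R :> R by [].
have sm m n : (m < n)%N -> laguerre_functional a (lag a n * lag a m) = 0.
  move=> mn; rewrite laguerre_functional_lag ?(lag_monic_size a m).2//;
    last exact: ltnW.
  by rewrite nth_default ?mul0r// (lag_monic_size a m).2.
split => [n|n|m n|n].
- exact: (lag_monic_size a n).1.
- exact: (lag_monic_size a n).2.
- by rewrite neq_ltn => /orP[mn|nm]; [rewrite mulrC sm|exact: sm].
- rewrite expr2 laguerre_functional_lag// ?(lag_monic_size a n).2//.
  rewrite lag_lead mul1r mulf_neq0// ?pnatr_eq0 -?lt0n ?fact_gt0// gt_eqF//.
  apply: Gamma_gt0.
  by have := n0 n; lra.
Qed.

Lemma laguerreE a : -1 < a -> laguerre a = lag a.
Proof.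
move=> a1; apply: monic_orthogonalE; last exact: lag_orthogonal.
  by move=> p q; exact: laguerre_functionalD.
by move=> c p; exact: laguerre_functionalZ.
Qed.

Lemma laguerre_normE a n : -1 < a ->
  laguerre_norm a n = n`!%:R * Gamma (a + n%:R + 1).
Proof.
move=> a1; rewrite /laguerre_norm laguerreE// expr2 laguerre_functional_lag//.
  by rewrite lag_lead mul1r.
by rewrite (lag_monic_size a n).2.
Qed.

(** In the recursion, coefficient k of L_(n+1)^a is coefficient k - 1 of L_n^(a+1) minus (a + 1 + k)
    times its coefficient k. As a + 1 + k > 0, the two contributions have the same sign. *)
Lemma coef_lag_sign a n k : -1 < a -> 0 <= (-1) ^+ (n + k) * (lag a n)`_k.
Proof.
elim: n a k => [|n IHn] a k a1.
  by rewrite coef1; case: k => [|k]; rewrite ?mulr0// mulr1 expr0.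
have a2 : -1 < a + 1 by lra.
rewrite /= mulrBl !coefB coefCM !coefXM.
case: k => [|k] /=.
  have := IHn _ 0 a2; rewrite !addn0 exprS subr0 sub0r.
  move: (_ ^+ _) (_`_0) => u v uv.
  by rewrite (_ : _ * _ = (a + 1) * (u * v)); [rewrite mulr_ge0//; lra|ring].
rewrite coef_deriv -mulr_natr.
have := IHn _ k a2; have := IHn _ k.+1 a2; rewrite !addnS !addSn !exprS.
move: (_ ^+ _) (_`_k.+1) (_`_k) => u v w uv uw.
rewrite (_ : _ * _ = u * w + (a + 1 + k.+1%:R) * (- 1 * u * v)); last by ring.
by rewrite addr_ge0// mulr_ge0// addr_ge0//; lra.
Qed.

(** At x < 0 the alternating signs make every term of (-1)^n L_n^a(x) nonnegative, and the top term
    is (-x)^n > 0. *)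
Lemma lag_lt0_sign a n x : -1 < a -> x < 0 -> 0 < (-1) ^+ n * (lag a n).[x].
Proof.
move=> a1 x0.
rewrite horner_coef (lag_monic_size a n).2 big_ord_recr/= lag_lead mulrDr ltr_wpDl//.
  rewrite mulr_sumr sumr_ge0// => i _.
  have := coef_lag_sign n i a1; rewrite exprD => h.
  have e : (-1) ^+ i * (-1) ^+ i = 1 :> R by rewrite -expr2 sqrr_sign.
  rewrite -[leRHS]mul1r -{1}e.
  rewrite (_ : _ * _ =
    (-1) ^+ n * (-1) ^+ i * (lag a n)`_i * ((-1) ^+ i * x ^+ i)); last by ring.
  by rewrite -exprNn mulr_ge0// exprn_ge0// oppr_ge0 ltW.
by rewrite mul1r -exprMn mulN1r exprn_gt0// oppr_gt0.
Qed.

Lemma lag_lt0_neq0 a n x : -1 < a -> x < 0 -> (lag a n).[x] != 0.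
Proof.
move=> a1 x0; have := lag_lt0_sign n a1 x0.
by apply: contraTneq => ->; rewrite mulr0 ltxx.
Qed.

End laguerre_polynomials.

(** * The functional c0 and the formulas for P_n, its norm and sigma_n *)

Lemma c0E (R : realType) (alpha xi : R) :
  c0 alpha xi = fun p => laguerre_functional (alpha - 1) (('X - xi%:P) * p).
Proof.
apply/funext => p; apply: eq_Rintegral => x _.
by rewrite hornerM hornerXsubC; ring.
Qed.

Theorem theorem2p1 (R : realType) (alpha xi : R) (halpha : 0 < alpha)
    (hxi : xi < 0) :
  let L := laguerre (alpha - 1) in
  let k := laguerre_norm (alpha - 1) in
  let N := laguerre_kernel (alpha - 1) in
  let P := monic_orthogonal (c0 alpha xi) in
  let T := monic_orthogonal (c1 alpha) in
  [/\ forall (n : nat) (x : R), (P n).[x] = N n x xi * (k n / (L n).[xi]),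
      forall n : nat, c0 alpha xi (P n ^+ 2) =
        - (n`!%:R * Gamma (alpha + n%:R) * ((L n.+1).[xi] / (L n).[xi])) &
      forall n : nat, (1 <= n)%N -> forall sigma : R,
        coherence_relation P T n sigma <->
        sigma = n%:R * (n%:R + alpha) * ((L n).[xi] / (L n.+1).[xi])].
Proof.
move=> L k N P T.
have a1 : -1 < alpha - 1 by lra.
have a2 : -1 < alpha by lra.
set c := laguerre_functional (alpha - 1).
have cD p q : c (p + q) = c p + c q by exact: laguerre_functionalD.
have cZ b p : c (b *: p) = b * c p by exact: laguerre_functionalZ.
have cL : is_monic_orthogonal c L by rewrite /L laguerreE//; exact: lag_orthogonal.
have L0 n : (L n).[xi] != 0 by rewrite /L laguerreE//; exact: lag_lt0_neq0.
have kc n : c (L n ^+ 2) = k n by [].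
have kE n : k n = n`!%:R * Gamma (alpha + n%:R).
  by rewrite /k laguerre_normE//; congr (_ * Gamma _); ring.
have PE : P = christoffel c L xi.
  rewrite /P c0E; apply: monic_orthogonalE.
  - by move=> p q; rewrite mulrDr; exact: cD.
  - by move=> b p; rewrite -scalerAr; exact: cZ.
  - exact: christoffel_orthogonal.
have Psize n : size (P n) = n.+1 by rewrite PE (christoffel_monic cL L0 n).2.
have Pmonic n : P n \is monic by rewrite PE (christoffel_monic cL L0 n).1.
split=> [n x|n|n n1 sigma].
- rewrite PE /christoffel hornerZ mulrC; congr (_ * _).
  rewrite /poly_kernel /N /laguerre_kernel horner_sum; apply: eq_bigr => j _.
  by rewrite hornerZ; ring.
- by rewrite c0E PE -/c (christoffel_norm cD cZ cL L0) kc kE.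
have TE : (n.+1%:R)^-1 *: (L n.+1)^`() = T n.
  rewrite /L /T laguerreE// deriv_lagS scalerA mulVf// scale1r.
  by rewrite -/(laguerre alpha) laguerreE// subrK.
(* Norm ratio from Gamma(alpha + n + 1) = (alpha + n) Gamma(alpha + n); it supplies the factor n +
   alpha of sigma_n. *)
have kS : k n.+1 / k n = n.+1%:R * (n%:R + alpha).
  have G0 : Gamma (alpha + n%:R) != 0.
    by rewrite gt_eqF// Gamma_gt0// ltr_wpDr.
  have f0 : n`!%:R != 0 :> R by rewrite pnatr_eq0 -lt0n fact_gt0.
  rewrite !kE factS natrM -(natr1 n) addrA GammaS; last by rewrite ltr_wpDr.
  by field; rewrite G0 f0.
have n0 : n%:R != 0 :> R by rewrite pnatr_eq0 -lt0n.
set s0 := n%:R * _ * _.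
have rel : coherence_relation P T n s0.
  (* Only P_(n+1) is expanded, as L_(n+1) plus a multiple of P_n; after differentiation and division
     by n + 1 the first term is T_n and the second cancels against the sigma_n term. *)
  rewrite /coherence_relation {1}PE (christoffelS cL L0) -PE derivD derivZ.
  rewrite !kc kS scalerDr TE scalerA -[LHS]addr0 -addrA; congr (_ + _).
  apply/esym/eqP; rewrite subr_eq0; apply/eqP; congr (_ *: _).
  by rewrite /s0; field; rewrite n0 L0 addrC natr1 pnatr_eq0.
(* Uniqueness: two values of sigma differ by a factor annihilating P_n', which is nonzero because
   its leading coefficient is n >= 1. *)
split=> [|->//]; rewrite /coherence_relation rel => /eqP.
rewrite (can_eq (addKr _)) eqr_opp -subr_eq0 -scalerBl scaler_eq0 => /orP[|].
  rewrite subr_eq0 => /eqP /(mulIf (invr_neq0 n0)) ->//.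
rewrite -size_poly_eq0 => /eqP dP0.
have : (P n)^`()`_n.-1 = 0 by rewrite nth_default// dP0.
have Pn : (P n)`_n = 1.
  by have /monicP := Pmonic n; rewrite /lead_coef Psize.
by rewrite coef_deriv prednK// Pn => /eqP; rewrite (negbTE n0).
Qed.
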